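(* Let $(\mathcal{X},d)$ be a Polish metric space and let $(X_N)_{N\in\mathbb{N}}$ be a Markov chain on $\mathcal{X}$ with transition kernel $(P_x)_{x\in\mathcal{X}}$, where $x\mapsto P_x$ is measurable and each $P_x$ has finite first moment. Assume there exists $\kappa>0$ such that $W_1(P_x,P_y)\le(1-\kappa)\,d(x,y)$ for all $x,y$, and that $\sigma_\infty<\infty$ and $\sup_x\sigma(x)^2/n_x<\infty$. Let $T\ge1$, $T_0\ge0$ be integers, $\hat\pi(f):=\frac1T\sum_{k=T_0+1}^{T_0+T}f(X_k)$, and \[ V^2:=\frac{1}{\kappa T}\Big(1+\frac{T_0}{T}\Big)\sup_{y\in\mathcal{X}}\frac{\sigma(y)^2}{n_y\kappa},\qquad r_{\max}:=\frac{4V^2\kappa T}{3\sigma_\infty}. \] Then for every non-constant Lipschitz $f:\mathcal{X}\to\mathbb{R}$, every $x\in\mathcal{X}$ and every $r>0$, \[ \mathbb{P}_x\Big(\frac{|\hat\pi(f)-\mathbb{E}_x\hat\pi(f)|}{\|f\|_{\mathrm{Lip}}}\ge r\Big)\le \begin{cases} 2e^{-r^2/(16V^2)}, & r\in(0,r_{\max}),\\ 2e^{-\kappa Tr/(12\sigma_\infty)}, & r\ge r_{\max}. \end{cases} \]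
   Context: $W_1$ is the $L^1$ Wasserstein distance. $\mathbb{P}_x,\mathbb{E}_x$ refer to the chain started at $X_0=x$. Granularity: $\sigma_\infty:=\frac12\sup_{x}\operatorname{diam}\operatorname{Supp}P_x$. $\sigma(x)^2:=\frac12\iint d(y,z)^2P_x(dy)P_x(dz)$; $n_x:=\inf\{\iint d(y,z)^2P_x(dy)P_x(dz)/\iint|g(y)-g(z)|^2P_x(dy)P_x(dz): g\ 1\text{-Lipschitz}\}$. $\|f\|_{\mathrm{Lip}}:=\sup_{x\ne y}|f(x)-f(y)|/d(x,y)$. *)

(* Defs.v *)
From HB Require Import structures.
From mathcomp Require Import all_boot all_order all_algebra.
From mathcomp Require Import all_classical all_reals all_analysis.
Set Implicit Arguments. Unset Strict Implicit. Unset Printing Implicit Defensive.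
Import Order.TTheory GRing.Theory Num.Theory.
Local Open Scope classical_set_scope.
Local Open Scope ring_scope.

Section MetricDefs.
Context {R : realType} {X : Type}.
Variable dist : X -> X -> R.

Definition is_metric : Prop :=
  [/\ (forall x y, 0 <= dist x y),
      (forall x y, dist x y = 0 <-> x = y),
      (forall x y, dist x y = dist y x) &
      (forall x y z, dist x z <= dist x y + dist y z)].

Definition dball (x : X) (e : R) : set X := [set y | dist x y < e].

Definition dopen (A : set X) : Prop :=
  forall x, A x -> exists2 e : R, 0 < e & dball x e `<=` A.

Definition dcauchy (u : nat -> X) : Prop :=
  forall e : R, 0 < e -> exists N : nat,
    forall m n : nat, (N <= m)%N -> (N <= n)%N -> dist (u m) (u n) < e.

Definition dconverges (u : nat -> X) (l : X) : Prop :=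
  forall e : R, 0 < e -> exists N : nat, forall n : nat, (N <= n)%N -> dist (u n) l < e.

Definition dcomplete : Prop :=
  forall u : nat -> X, dcauchy u -> exists l, dconverges u l.

Definition dseparable : Prop :=
  exists s : nat -> X, forall x (e : R), 0 < e -> exists n, dist x (s n) < e.

Definition polish_metric : Prop := [/\ is_metric, dcomplete & dseparable].

Definition lipnorm (f : X -> R) : \bar R :=
  ereal_sup [set r | exists x y, x <> y /\ r = (`|f x - f y| / dist x y)%:E].

Definition one_lipschitz (g : X -> R) : Prop :=
  forall y z, `|g y - g z| <= dist y z.

(** diameter of a set, in \bar R (sup of empty set is -oo) *)
Definition ddiam (A : set X) : \bar R :=
  ereal_sup [set (dist y z)%:E | y in A & z in A].
End MetricDefs.

Section MeasureDefs.
Context {R : realType} {d : measure_display} {X : measurableType d}.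
Variable dist : X -> X -> R.

Definition borel_of_metric : Prop :=
  forall A : set X, measurable A <-> <<s dopen dist >> A.

Definition dsupport (mu : {measure set X -> \bar R}) : set X :=
  [set y | forall e : R, 0 < e -> (0 < mu (dball dist y e))%E].

Definition coupling (mu nu : {measure set X -> \bar R})
  (xi : probability (X * X)%type R) : Prop :=
  forall A : set X, measurable A ->
    xi (A `*` setT) = mu A /\ xi (setT `*` A) = nu A.

Definition W1 (mu nu : {measure set X -> \bar R}) : \bar R :=
  ereal_inf [set (\int[xi]_p (dist p.1 p.2)%:E)%E |
              xi in [set xi : probability (X * X)%type R | coupling mu nu xi]].

Definition finite_first_moment (mu : {measure set X -> \bar R}) : Prop :=
  exists x0 : X, (\int[mu]_y (dist x0 y)%:E < +oo)%E.

Variable P : R.-pker X ~> X.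

Definition sigma_inf : \bar R :=
  ((2 : R)^-1%:E * ereal_sup [set ddiam dist (dsupport (P x)) | x in [set: X]])%E.

Definition dd2 (x : X) : \bar R :=
  (\int[P x]_y \int[P x]_z ((dist y z) ^+ 2)%:E)%E.
Definition sigma2 (x : X) : \bar R := ((2 : R)^-1%:E * dd2 x)%E.

Definition eratio (a b : \bar R) : \bar R :=
  if b == 0%E then +oo%E else (a * b^-1)%E.

Definition ndim (x : X) : \bar R :=
  ereal_inf [set eratio (dd2 x)
                 (\int[P x]_y \int[P x]_z ((g y - g z) ^+ 2)%:E)%E
            | g in [set g : X -> R | one_lipschitz dist g]].

Definition sup_sigma2_n : \bar R :=
  ereal_sup [set (sigma2 x * (ndim x)^-1)%E | x in [set: X]].

(** Law of the chain started at x: for F a nonnegative functional of the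
    path (X_1, ..., X_n) (given as the list [:: X_1; ...; X_n]),
    chainE n x F = E_x[F(X_1, ..., X_n)], defined by iterated integration
    against the transition kernel (Ionescu-Tulcea). *)
Fixpoint chainE (n : nat) (x : X) (F : seq X -> \bar R) : \bar R :=
  match n with
  | 0%N => F [::]
  | n'.+1 => (\int[P x]_y chainE n' y (fun s => F (y :: s)))%E
  end.

Definition chainP (n : nat) (x : X) (A : set (seq X)) : \bar R :=
  chainE n x (fun s => (\1_A s)%:E).

Definition chainExp (n : nat) (x : X) (h : seq X -> R) : R :=
  fine (chainE n x (fun s => (Num.max (h s) 0)%:E))
  - fine (chainE n x (fun s => (Num.max (- h s) 0)%:E)).

(** empirical mean hat pi(f) = 1/T sum_{k=T0+1}^{T0+T} f(X_k),
    evaluated on the path s = [:: X_1; ...; X_{T0+T}] (x0 is an unused default) *)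
Definition pihat (x0 : X) (T T0 : nat) (f : X -> R) (s : seq X) : R :=
  (T%:R)^-1 * \sum_(T0.+1 <= k < (T0 + T).+1) f (nth x0 s k.-1).
End MeasureDefs.

(* Main.v *)
Require Import Defs.
From HB Require Import structures.
From mathcomp Require Import all_boot all_order all_algebra.
From mathcomp Require Import all_classical all_reals all_analysis.
From mathcomp Require Import measurable_realfun ring lra.
Import Order.TTheory GRing.Theory Num.Theory.
Local Open Scope classical_set_scope.
Local Open Scope ring_scope.

(** Contraction in [W1] makes the conditional expectations of the empirical mean
    given [X_1, ..., X_k] Lipschitz in [X_k] with constant [L / (kappa T)].
    One step of the chain multiplies the Laplace transform at [t] of a
    1-Lipschitz function by at most [exp (4 t^2 sigma(x)^2 / n_x)], because
    [exp s <= 1 + s + 2 s^2] for [s <= 1/2] and because, almost surely, such a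
    function is within [2 sigma_infty] of its mean.  Iterating over the
    [T0 + T] steps gives a Gaussian Laplace bound for small [t], and Chernoff's
    method with [t] either optimal or at the edge of the admissible range gives
    the two regimes.  Path functionals are not shown to be measurable: the
    iterated integral is only used through its monotonicity, and each
    dominating integrand is a function of a Lipschitz map. *)

(** * Monotonicity of the integral for arbitrary integrands *)

Section integral_monotone.
Context {d : measure_display} {T : measurableType d} {R : realType}.
Variable mu : {measure set T -> \bar R}.
Implicit Types f g : T -> \bar R.
Local Open Scope ereal_scope.

(** The integral of a nonnegative function is a supremum over the simple functions below it, and a
    larger function has more of them; measurability does not enter. *)
Lemma ge0_le_integral_pointwise f g : (forall x, 0 <= f x) ->
  (forall x, f x <= g x) -> \int[mu]_x f x <= \int[mu]_x g x.
Proof.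
move=> f0 fg; have g0 x : 0 <= g x by apply: le_trans (fg x).
rewrite !ge0_integralTE//; apply: ge_ereal_sup => _ [h hf <-].
by apply: ereal_sup_ubound; exists h => //= x; apply: le_trans (hf x) (fg x).
Qed.

Lemma le_integral_pointwise f g :
  (forall x, f x <= g x) -> \int[mu]_x f x <= \int[mu]_x g x.
Proof.
move=> fg; rewrite integralE [leRHS]integralE leeB//.
- apply: ge0_le_integral_pointwise => // x.
  by apply: (funepos_le (D := setT)) (in_setT x) => y _; exact: fg.
- apply: ge0_le_integral_pointwise => // x.
  by apply: (funeneg_le (D := setT)) (in_setT x) => y _; exact: fg.
Qed.

(** Redefining [g] as [+oo] on a measurable null set preserves its integral and makes the comparison
    hold everywhere. Only the dominating function has to be measurable. *)
Lemma ae_le_integral f g : measurable_fun setT g ->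
  {ae mu, forall x, f x <= g x} -> \int[mu]_x f x <= \int[mu]_x g x.
Proof.
move=> mg [N [mN N0 fgN]].
pose g' x := if x \in N then +oo else g x.
have mg' : measurable_fun setT g'.
  apply: measurable_fun_ifT => //.
  by apply: (measurable_fun_bool true); rewrite setTI preimage_mem_true.
have -> : \int[mu]_x g x = \int[mu]_x g' x.
  apply: ae_eq_integral => //; exists N; split => // x /= /not_implyP[_].
  by rewrite /g'; case: (boolP (x \in N)) => [/set_mem //|_ []].
apply: le_integral_pointwise => x; rewrite /g'.
case: (boolP (x \in N)) => [_|/negP xN]; first exact: leey.
apply: contrapT => h; apply: xN; apply/mem_set; exact: fgN.
Qed.

End integral_monotone.

(** * Constants and real-valued integrals under a probability measure *)

Section probability_Rintegral.
Context {d : measure_display} {T : measurableType d} {R : realType}.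
Variable mu : {measure set T -> \bar R}.
Hypothesis mu1 : mu setT = 1%E.
Implicit Types f g : T -> R.

Lemma probability_integral_cst (c : \bar R) : (\int[mu]_x c = c)%E.
Proof. by rewrite integral_cst// mu1 mule1. Qed.

Lemma probability_integrable_cst (c : R) : mu.-integrable setT (fun _ => c%:E).
Proof.
apply/integrableP; split; first exact: measurable_cst.
by rewrite probability_integral_cst ltry.
Qed.

Lemma EFin_Rintegral f : mu.-integrable setT (EFin \o f) ->
  (\int[mu]_x (f x)%:E = (\int[mu]_x f x)%R%:E)%E.
Proof. by move=> fi; rewrite /Rintegral fineK//; exact: integrable_fin_num. Qed.

Lemma probability_RintegralDcst f c : mu.-integrable setT (EFin \o f) ->
  \int[mu]_x (f x + c) = \int[mu]_x f x + c.
Proof.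
move=> fi; rewrite RintegralD//; last exact: probability_integrable_cst.
by rewrite /Rintegral probability_integral_cst.
Qed.

End probability_Rintegral.

(** * Lipschitz functions: measurability, integrability, and duality with [W1] *)

Definition dlipschitz {R : realType} {X : Type} (dist : X -> X -> R) (K : R)
  (g : X -> R) : Prop := forall y z, `|g y - g z| <= K * dist y z.

Section lipschitz_measure.
Context {d : measure_display} {X : measurableType d} {R : realType}.
Variables (dist : X -> X -> R).
Hypotheses (Hd : is_metric dist) (Hborel : borel_of_metric dist).

Lemma dist_ge0 y z : 0 <= dist y z. Proof. by case: Hd. Qed.
Lemma dist_sym y z : dist y z = dist z y. Proof. by case: Hd. Qed.
Lemma dist_triangle u y z : dist u z <= dist u y + dist y z.
Proof. by case: Hd. Qed.

Lemma dopen_measurable (A : set X) : dopen dist A -> measurable A.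
Proof. by move=> A0; apply/Hborel; exact: sub_gen_smallest. Qed.

Lemma dball_measurable x e : measurable (dball dist x e).
Proof.
apply: dopen_measurable => y xy; exists (e - dist x y); first by rewrite subr_gt0.
move=> z yz; apply: le_lt_trans (dist_triangle x y z) _.
by rewrite /dball/= in xy yz *; lra.
Qed.

Lemma dlipschitz_dist x : dlipschitz dist 1 (dist x).
Proof.
move=> y z; rewrite mul1r ler_norml.
have := dist_triangle x y z; have := dist_triangle x z y.
by rewrite (dist_sym z y); lra.
Qed.

Lemma measurable_dlipschitz K g : 0 <= K -> dlipschitz dist K g ->
  measurable_fun setT g.
Proof.
move=> K0 gK mD; apply: (measurability _ (RGenOInfty.measurableE R)) => //.
move=> /= _ [_ [a ->] <-]; apply: measurableI => //; apply: dopen_measurable.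
move=> y; rewrite /= in_itv/= andbT => ay.
(* Dividing by [K + 1] instead of [K] gives a valid radius also when [K = 0]. *)
have K1 : 0 < K + 1 by lra.
exists ((g y - a) / (K + 1)); first by rewrite divr_gt0// subr_gt0.
move=> z; rewrite /dball/= ltr_pdivlMr// in_itv/= andbT => yz.
have := gK y z; rewrite ler_norml; have := dist_ge0 y z; nra.
Qed.

Lemma dlipschitzM c K g : dlipschitz dist K g ->
  dlipschitz dist (`|c| * K) (fun y => c * g y).
Proof.
by move=> gK y z; rewrite -mulrBr normrM -mulrA ler_wpM2l//; exact: gK.
Qed.

Section probability.
Variable mu : {measure set X -> \bar R}.
Hypotheses (mu1 : mu setT = 1%E).

(** Domination by [|g x0| + K * dist x0 y], whose integral is finite by the first moment. *)
Lemma integrable_dlipschitz K g : finite_first_moment dist mu ->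
  0 <= K -> dlipschitz dist K g -> mu.-integrable setT (EFin \o g).
Proof.
move=> [x0 x0oo] K0 gK.
have mx0 : measurable_fun setT (dist x0).
  exact: measurable_dlipschitz ler01 (dlipschitz_dist x0).
have ix0 : mu.-integrable setT (EFin \o dist x0).
  apply/integrableP; split; first exact/measurable_EFinP.
  under eq_integral do rewrite /= ger0_norm ?dist_ge0//.
  by [].
apply: (le_integrable _ (g := (fun=> `|g x0|%:E) \+ (fun y => K%:E * (dist x0 y)%:E)%E)) => //.
- by apply/measurable_EFinP; exact: measurable_dlipschitz gK.
- move=> y _; rewrite /=.
  rewrite lee_fin [leRHS]ger0_norm; last first.
    by rewrite addr_ge0// mulr_ge0// dist_ge0.
  rewrite -lerBlDl; apply: le_trans (gK x0 y).
  by rewrite (distrC (g x0)); exact: lerB_dist.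
- apply: integrableD => //; first exact: probability_integrable_cst.
  exact: integrableZl.
Qed.

(** A point outside the support has a null ball around it, hence lies in a null ball of radius
    [1 / (k + 1)] centred at a point of the dense sequence. There are countably many such balls. *)
Lemma ae_dsupport : dseparable dist -> {ae mu, forall y, dsupport dist mu y}.
Proof.
move=> [s Hs].
pose B n k := dball dist (s n) (k.+1%:R^-1).
pose N n k := if mu (B n k) == 0%E then B n k else set0.
have nN n : mu.-negligible (\bigcup_k N n k).
  apply: negligible_bigcup => k /=; rewrite /N; case: eqP => [h|_].
    by apply/negligibleP => //; exact: dball_measurable.
  exact: negligible_set0.
apply: negligibleS (negligible_bigcup nN) => y /= /existsNP[e] /not_implyP[e0 /negP].
rewrite -leNgt => mue.
have [k ke] : exists k, k.+1%:R^-1 < e / 2.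
  have [k] := @ltr_add_invr R 0 (e / 2) ltac:(lra).
  by rewrite add0r; exists k.
have [n yn] := Hs y (k.+1%:R^-1) (ltac:(by rewrite invr_gt0 ltr0n)).
exists n => //; exists k => //; rewrite /N ifT /B /dball/= ?(dist_sym (s n))//.
rewrite eq_le measure_ge0 andbT; apply: le_trans mue.
apply: le_measure; rewrite ?inE; [exact: dball_measurable..|].
rewrite /B /dball => z /= h.
apply: le_lt_trans (dist_triangle y (s n) z) _; apply: lt_trans (ltrD yn h) _.
by rewrite [ltRHS]splitr ltrD.
Qed.
End probability.

(** Change of variables: the image of [xi] under [phi] agrees with [mu] on measurable sets. It
    serves for the two projections of a coupling. *)
Lemma marginal_Rintegral (xi : {measure set (X * X)%type -> \bar R})
    (mu : {measure set X -> \bar R}) (phi : X * X -> X) (g : X -> R) :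
  measurable_fun setT phi ->
  (forall A, measurable A -> xi (phi @^-1` A) = mu A) ->
  mu.-integrable setT (EFin \o g) ->
  xi.-integrable setT (EFin \o (g \o phi)) /\
  \int[xi]_p g (phi p) = \int[mu]_y g y.
Proof.
move=> mphi xim gi; have mg : measurable_fun setT (EFin \o g).
  by case/integrableP : gi.
pose phi' : {mfun (X * X)%type >-> X} :=
  HB.pack phi (isMeasurableFun.Build _ _ _ _ phi mphi).
have E (f : X -> \bar R) : (\int[pushforward xi phi']_y f y = \int[mu]_y f y)%E.
  by apply: eq_measure_integral => A mA _; exact: xim.
have xii : xi.-integrable setT (EFin \o (g \o phi)).
  apply/integrableP; split; first exact: (measurableT_comp mg).
  case/integrableP : gi => _; rewrite -E ge0_integral_pushforward//.
  exact: measurableT_comp.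
split => //; rewrite /Rintegral -E.
by rewrite (integral_pushforward mphi mg).
Qed.

(** The easy half of Kantorovich-Rubinstein duality: under any coupling the left side is the
    integral of [g p.1 - g p.2], which [dist] dominates pointwise. *)
Lemma Rintegral_sub_le_W1 (mu nu : {measure set X -> \bar R}) g :
  one_lipschitz dist g -> mu.-integrable setT (EFin \o g) ->
  nu.-integrable setT (EFin \o g) ->
  ((\int[mu]_y g y - \int[nu]_y g y)%:E <= W1 dist mu nu)%E.
Proof.
move=> g1 mui nui; apply: le_ereal_inf_tmp => _ [xi xic <-].
have [i1 e1] := @marginal_Rintegral xi mu fst g measurable_fst
  (fun A mA => (ltac:(by rewrite -(xic A mA).1; congr (xi _); apply/seteqP; split => -[] //= ? ? [])))
  mui.
have [i2 e2] := @marginal_Rintegral xi nu snd g measurable_snd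
  (fun A mA => (ltac:(by rewrite -(xic A mA).2; congr (xi _); apply/seteqP; split => -[] //= ? ? [])))
  nui.
rewrite -e1 -e2 -RintegralB// -EFin_Rintegral; last by have := integrableB measurableT i1 i2.
apply: le_integral_pointwise => p; rewrite lee_fin.
exact: le_trans (ler_norm _) (g1 _ _).
Qed.

End lipschitz_measure.

(** * Laplace transform of a Lipschitz function under one probability measure *)

Lemma expR_le_quadratic (R : realType) (t : R) : t <= 2^-1 ->
  expR t <= 1 + t + 2 * t ^+ 2.
Proof.
move=> t12; have t1 : 0 < 1 - t by lra.
(* After multiplication by [1 - t], the value 1 separates the two sides: [1 - t <= expR (- t)]
   bounds the left one, and the right one is [1 + t^2 (1 - 2t)]. *)
rewrite -(ler_pM2r t1); apply: (@le_trans _ _ 1).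
  rewrite -[leRHS](expRxMexpNx_1 t) ler_wpM2l ?expR_ge0//.
  exact: expR_ge1Dx.
have -> : (1 + t + 2 * t ^+ 2) * (1 - t) = 1 + t ^+ 2 * (1 - 2 * t) by ring.
by rewrite lerDl mulr_ge0 ?sqr_ge0//; lra.
Qed.

Section one_step_concentration.
Context {d : measure_display} {X : measurableType d} {R : realType}.
Variables (dist : X -> X -> R).
Hypotheses (Hd : is_metric dist) (Hborel : borel_of_metric dist).
Variable mu : {measure set X -> \bar R}.
Hypotheses (mu1 : mu setT = 1%E) (Hmom : finite_first_moment dist mu).
Variables (A : set X) (D : R).
Hypotheses (Hae : {ae mu, forall y, A y})
  (HD : forall y z, A y -> A z -> dist y z <= D).

Lemma double_integral_dist2_le :
  (\int[mu]_y \int[mu]_z ((dist y z) ^+ 2)%:E <= (D ^+ 2)%:E)%E.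
Proof.
rewrite -[leRHS](probability_integral_cst mu mu1).
apply: ae_le_integral; first exact: measurable_cst.
apply: filterS Hae => y Ay; rewrite -[leRHS](probability_integral_cst mu mu1).
apply: ae_le_integral; first exact: measurable_cst.
apply: filterS Hae => z Az; have := HD y z Ay Az.
rewrite lee_fin => yz; have := dist_ge0 dist Hd y z; nra.
Qed.

Variable g : X -> R.
Hypothesis g1 : one_lipschitz dist g.
Let m := \int[mu]_y g y.

Lemma one_lipschitz_dlipschitz : dlipschitz dist 1 g.
Proof. by move=> y z; rewrite mul1r; exact: g1. Qed.

Let gi : mu.-integrable setT (EFin \o g).
Proof. exact: integrable_dlipschitz one_lipschitz_dlipschitz. Qed.

Let mg : measurable_fun setT g.
Proof. exact: measurable_dlipschitz one_lipschitz_dlipschitz. Qed.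

Lemma Rintegral_affine c0 c1 :
  mu.-integrable setT (fun y => (c1 * g y + c0)%:E) /\
  \int[mu]_y (c1 * g y + c0) = c1 * m + c0.
Proof.
have i1 : mu.-integrable setT (EFin \o (fun y => c1 * g y)).
  exact: (integrableZl measurableT c1 gi).
split; last by rewrite probability_RintegralDcst// RintegralZl.
exact: (integrableD measurableT i1 (probability_integrable_cst mu mu1 c0)).
Qed.

(** For [y] in [A], [g y - m] is the mean over [z] of [g y - g z], and almost every [z] is within
    [D] of [y]. *)
Lemma ae_norm_centered_le : {ae mu, forall y, `|g y - m| <= D}.
Proof.
apply: filterS Hae => y Ay.
have [i1 e1] := Rintegral_affine (g y) (-1).
have -> : g y - m = \int[mu]_z (-1 * g z + g y) by rewrite e1; ring.
apply: le_trans (le_normr_Rintegral _ i1) _ => //.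
rewrite -lee_fin -EFin_Rintegral; last exact: integrable_norm i1.
rewrite -[leRHS](probability_integral_cst mu mu1).
apply: ae_le_integral; first exact: measurable_cst.
apply: filterS Hae => z Az; rewrite lee_fin mulN1r addrC.
exact: le_trans (g1 _ _) (HD _ _ Ay Az).
Qed.

(** Jensen's inequality in the inner variable, at each fixed [y]. *)
Lemma variance_le_double_integral :
  (\int[mu]_y ((g y - m) ^+ 2)%:E
   <= \int[mu]_y \int[mu]_z ((g y - g z) ^+ 2)%:E)%E.
Proof.
apply: le_integral_pointwise => y.
(* The affine function of [g z] is the tangent at [g z = m] to [(g y - g z)^2]; it lies below the
   square by exactly [(m - g z)^2] and has mean [(g y - m)^2]. *)
have [i1 e1] := Rintegral_affine ((g y - m) ^+ 2 + 2 * (g y - m) * m) (- (2 * (g y - m))).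
have -> : (g y - m) ^+ 2 =
    \int[mu]_z (- (2 * (g y - m)) * g z + ((g y - m) ^+ 2 + 2 * (g y - m) * m)).
  by rewrite e1; ring.
rewrite -EFin_Rintegral//; apply: le_integral_pointwise => z; rewrite lee_fin.
by have := sqr_ge0 (m - g z); nra.
Qed.

Variable S : R.
Hypothesis HS :
  (\int[mu]_y \int[mu]_z ((g y - g z) ^+ 2)%:E <= (2 * S)%:E)%E.

(** Almost surely [|a (g y - m)| <= 1/2], so the quadratic bound on the exponential applies. The
    linear term has mean zero, the quadratic one contributes at most [2 a^2 * (2 S)], whence the 4,
    and [1 + x <= expR x] concludes. *)
Lemma one_lipschitz_mgf_le a : `|a| * D <= 2^-1 ->
  (\int[mu]_y (expR (a * g y))%:E <= (expR (a * m + 4 * a ^+ 2 * S))%:E)%E.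
Proof.
move=> aD; pose q y := (g y - m) ^+ 2.
have q0 y : 0 <= q y by exact: sqr_ge0.
have mq : measurable_fun setT q.
  by apply: measurable_funX; apply: measurable_funB => //; exact: measurable_cst.
have vq := le_trans variance_le_double_integral HS.
have iq : mu.-integrable setT (EFin \o q).
  apply/integrableP; split; first exact/measurable_EFinP.
  under eq_integral do rewrite /= ger0_norm//.
  by apply: le_lt_trans vq _; exact: ltry.
have rq : \int[mu]_y q y <= 2 * S by rewrite -lee_fin -EFin_Rintegral.
pose c := expR (a * m).
(* [h1 + h2] is [c (1 + a (g - m) + 2 a^2 (g - m)^2)], split into an affine part in [g] and a
   multiple of [q]. *)
pose h1 y := (c * a) * g y + c * (1 - a * m).
pose h2 y := (2 * c * a ^+ 2) * q y.
have [i1 e1] := Rintegral_affine (c * (1 - a * m)) (c * a).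
have i2 : mu.-integrable setT (EFin \o h2).
  exact: (integrableZl measurableT (2 * c * a ^+ 2) iq).
have i12 : mu.-integrable setT (EFin \o (fun y => h1 y + h2 y)).
  exact: (integrableD measurableT i1 i2).
apply: (@le_trans _ _ (\int[mu]_y (h1 y + h2 y)%:E)%E).
  apply: ae_le_integral; first by case/integrableP : i12.
  apply: filterS ae_norm_centered_le => y yD; rewrite lee_fin.
  have -> : a * g y = a * m + a * (g y - m) by ring.
  have t12 : a * (g y - m) <= 2^-1.
    apply: le_trans (ler_norm _) _; rewrite normrM; apply: le_trans aD.
    by rewrite ler_wpM2l.
  rewrite expRD -/c.
  have -> : h1 y + h2 y =
      c * (1 + a * (g y - m) + 2 * (a * (g y - m)) ^+ 2).
    by rewrite /h1 /h2 /q; ring.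
  by rewrite ler_wpM2l ?expR_ge0//; exact: expR_le_quadratic.
rewrite EFin_Rintegral// lee_fin RintegralD// e1 RintegralZl// -/m expRD -/c.
have c0 : 0 <= c by exact: expR_ge0.
have a20 : 0 <= a ^+ 2 by exact: sqr_ge0.
apply: (@le_trans _ _ (c * (1 + 4 * a ^+ 2 * S))).
  have -> : c * a * m + c * (1 - a * m) + 2 * c * a ^+ 2 * \int[mu]_x q x =
     c * (1 + 2 * a ^+ 2 * \int[mu]_x q x) by ring.
  by rewrite ler_wpM2l//; nra.
by rewrite ler_wpM2l//; exact: expR_ge1Dx.
Qed.

End one_step_concentration.

(** * Consequences of finite granularity and of the bound on the variance-to-dimension ratio *)

Section kernel_bounds.
Context {d : measure_display} {X : measurableType d} {R : realType}.
Variables (dist : X -> X -> R) (P : R.-pker X ~> X).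
Hypotheses (Hpolish : polish_metric dist) (Hborel : borel_of_metric dist).
Hypothesis Hsinf : (sigma_inf dist P < +oo)%E.
Hypothesis Hsn : (sup_sigma2_n dist P < +oo)%E.

Let Hd : is_metric dist. Proof. by case: Hpolish. Qed.

Lemma ae_dsupport_kernel x : {ae P x, forall y, dsupport dist (P x) y}.
Proof. by apply: ae_dsupport => //; case: Hpolish. Qed.

Lemma dist_dsupport_le x y z : dsupport dist (P x) y -> dsupport dist (P x) z ->
  dist y z <= 2 * fine (sigma_inf dist P).
Proof.
move=> sy sz; move: Hsinf; rewrite /sigma_inf.
set s := ereal_sup _; have : ((dist y z)%:E <= s)%E.
  apply: (@le_trans _ _ (ddiam dist (dsupport dist (P x)))).
    by apply: ereal_sup_ubound; exists y => //; exists z.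
  by apply: ereal_sup_ubound; exists x.
case: s => [s| |] //; first by rewrite lee_fin => + _ /=; lra.
by rewrite gt0_muley.
Qed.

Lemma sup_sigma2_n_ge x : (sigma2 dist P x * (ndim dist P x)^-1
  <= sup_sigma2_n dist P)%E.
Proof. by apply: ereal_sup_ubound; exists x. Qed.

Lemma integral2_sqr_ge0 x (h : X -> X -> R) :
  (0 <= \int[P x]_y \int[P x]_z ((h y z) ^+ 2)%:E)%E.
Proof.
by do 2 apply: integral_ge0 => ? _; rewrite lee_fin sqr_ge0.
Qed.

Lemma double_integral_one_lipschitz_le_dd2 x g : one_lipschitz dist g ->
  (\int[P x]_y \int[P x]_z ((g y - g z) ^+ 2)%:E <= dd2 dist P x)%E.
Proof.
move=> g1; apply: le_integral_pointwise => y; apply: le_integral_pointwise => z.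
rewrite lee_fin -[leLHS]real_normK ?num_real//.
by rewrite lerXn2r ?nnegrE ?dist_ge0//; exact: g1.
Qed.

Lemma dd2_fin_num x : dd2 dist P x \is a fin_num.
Proof.
rewrite ge0_fin_numE ?integral2_sqr_ge0//.
apply: le_lt_trans (ltry ((2 * fine (sigma_inf dist P)) ^+ 2)).
exact: (double_integral_dist2_le dist Hd _ (prob_kernel x) _ _
  (ae_dsupport_kernel x) (dist_dsupport_le x)).
Qed.

(** Every ratio in the infimum is at least 1, since a 1-Lipschitz function does not increase
    distances. Positivity of [ndim] allows clearing it from denominators later. *)
Lemma ndim_ge1 x : dd2 dist P x != 0%E -> (1 <= ndim dist P x)%E.
Proof.
move=> a0; apply: le_ereal_inf_tmp => _ [g /= g1 <-].
rewrite /eratio; case: ifPn => [_|v0]; first exact: leey.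
have := double_integral_one_lipschitz_le_dd2 x g g1.
have := integral2_sqr_ge0 x (fun y z => g y - g z).
have := dd2_fin_num x; move: a0 v0; move: (dd2 _ _ _) (integral _ _ _).
move=> [a| |]// [v| |]//; rewrite !eqe => a0 v0 _; rewrite !lee_fin => v1 va.
by rewrite inver (negbTE v0) -EFinM lee_fin ler_pdivlMr ?mul1r// lt_neqAle eq_sym v0.
Qed.

Lemma sup_sigma2_n_fine_ge0 (x : X) : 0 <= fine (sup_sigma2_n dist P).
Proof.
apply: fine_ge0; apply: le_trans (sup_sigma2_n_ge x).
apply: mule_ge0; first by apply: mule_ge0 => //; exact: integral2_sqr_ge0.
rewrite inve_ge0; apply: le_ereal_inf_tmp => _ [g /= g1 <-].
rewrite /eratio; case: ifPn => [_|v0]; first exact: leey.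
by rewrite mule_ge0 ?inve_ge0 ?integral2_sqr_ge0.
Qed.

(* The double integral is twice the variance of [g], hence the factor 2. *)
Lemma double_integral_one_lipschitz_le x g : one_lipschitz dist g ->
  (\int[P x]_y \int[P x]_z ((g y - g z) ^+ 2)%:E
   <= (2 * fine (sup_sigma2_n dist P))%:E)%E.
Proof.
move=> g1; have va := double_integral_one_lipschitz_le_dd2 x g g1.
have v0 := integral2_sqr_ge0 x (fun y z => g y - g z).
have S0 := sup_sigma2_n_fine_ge0 x.
have [a0|a0] := eqVneq (dd2 dist P x) 0%E.
  by apply: le_trans va _; rewrite a0 lee_fin mulr_ge0.
have n1 := ndim_ge1 x a0.
have : (ndim dist P x <= eratio (dd2 dist P x)
    (\int[P x]_y \int[P x]_z ((g y - g z) ^+ 2)%:E))%E.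
  by apply: ereal_inf_lbound; exists g.
have := sup_sigma2_n_ge x; rewrite /eratio /sigma2.
move: n1 S0 Hsn v0 va a0 (dd2_fin_num x).
move: (integral _ _ _) (dd2 _ _ _) (ndim _ _ _) (sup_sigma2_n _ _).
move=> v [a| |]// n s n1 S0 soo v0 va a0 _.
case: ifPn => [/eqP -> _ _|vn0]; first by rewrite lee_fin mulr_ge0.
case: v => [v| |] // in v0 va vn0 *.
move: va v0 vn0 a0; rewrite !lee_fin !eqe => va v0 vn0 a0.
have {vn0} {}v0 : 0 < v by rewrite lt_neqAle eq_sym vn0.
rewrite inver gt_eqF// -EFinM => + nav.
case: n n1 nav => [n| |]//; rewrite !lee_fin => n1 nav.
rewrite inver gt_eqF; last by apply: lt_le_trans n1.
case: s S0 soo => [s| |]// S0 _; rewrite -!EFinM !lee_fin => h.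
have n0 : 0 < n by apply: lt_le_trans n1.
(* This gives [a <= 2 s n], while the infimum defining [n] gives [n v <= a]; cancelling [n] leaves
   [v <= 2 s]. *)
have : 2^-1 * a / n <= s by [].
rewrite ler_pdivrMr// => h2.
move: nav; rewrite ler_pdivlMr// => h3 /=.
by rewrite -(ler_pM2r n0); nra.
Qed.

End kernel_bounds.

(** * Coordinatewise Lipschitz path functionals and their expectations along the chain *)

Definition coord_lipschitz {R : realType} {X : Type} (dist : X -> X -> R) (K : R)
  (F : seq X -> R) : Prop :=
  forall p y z s, `|F (p ++ y :: s) - F (p ++ z :: s)| <= K * dist y z.

Lemma coord_lipschitz_cons (R : realType) (X : Type) (dist : X -> X -> R) K F y :
  coord_lipschitz dist K F -> coord_lipschitz dist K (fun s => F (y :: s)).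
Proof. by move=> FK p; exact: (FK (y :: p)). Qed.

Lemma ler_norm_max0 (R : realDomainType) (a b : R) :
  `|Num.max a 0 - Num.max b 0| <= `|a - b|.
Proof.
have := ler_norm (a - b); have := ler_norm (b - a); rewrite (distrC b).
by rewrite ler_norml; case: (leP a 0); case: (leP b 0); lra.
Qed.

(** A real-valued counterpart of [chainE], for which differences of expectations make sense; the two
    agree on coordinatewise Lipschitz functionals. *)
Fixpoint chainR {R : realType} {d : measure_display} {X : measurableType d}
    (P : R.-pker X ~> X) (n : nat) (x : X) (F : seq X -> R) : R :=
  match n with
  | 0%N => F [::]
  | n'.+1 => \int[P x]_y chainR P n' y (fun s => F (y :: s))
  end.

Section contracting_chain.
Context {d : measure_display} {X : measurableType d} {R : realType}.
Variables (dist : X -> X -> R) (P : R.-pker X ~> X).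
Hypotheses (Hpolish : polish_metric dist) (Hborel : borel_of_metric dist).
Hypothesis Hmom : forall x, finite_first_moment dist (P x).
Variable kappa : R.
Hypotheses (Hkappa : 0 < kappa) (Hkappa1 : kappa <= 1).
Hypothesis Hcontr : forall x y : X,
  (W1 dist (P x) (P y) <= ((1 - kappa) * dist x y)%:E)%E.

Let Hd : is_metric dist. Proof. by case: Hpolish. Qed.

Let integrable_kernel x A g : 0 < A -> dlipschitz dist A g ->
  (P x).-integrable setT (EFin \o g).
Proof.
move=> A0; apply: (integrable_dlipschitz dist Hd Hborel) (ltW A0).
  exact: prob_kernel.
exact: Hmom.
Qed.

Lemma dlipschitz_normalize A g : 0 < A -> dlipschitz dist A g ->
  one_lipschitz dist (fun y => A^-1 * g y).
Proof.
move=> A0 gA y z; apply: le_trans (dlipschitzM dist A^-1 _ _ gA y z) _.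
by rewrite gtr0_norm ?invr_gt0// mulVf ?gt_eqF// mul1r.
Qed.

(** The dual form of [Hcontr], obtained by testing [W1] against the 1-Lipschitz function [g / A]. *)
Lemma kernel_contraction A g : 0 < A -> dlipschitz dist A g ->
  dlipschitz dist (A * (1 - kappa)) (fun x => \int[P x]_y g y).
Proof.
move=> A0 gA.
suff H x y : \int[P x]_z g z - \int[P y]_z g z <= A * (1 - kappa) * dist x y.
  move=> x y; rewrite ler_norml H andbT.
  by have := H y x; rewrite (dist_sym dist Hd y x); lra.
have g1 := dlipschitz_normalize _ _ A0 gA.
have gi u : (P u).-integrable setT (EFin \o (fun y => A^-1 * g y)).
  exact: (integrableZl measurableT A^-1 (integrable_kernel u _ _ A0 gA)).
have := le_trans (Rintegral_sub_le_W1 dist _ _ _ g1 (gi x) (gi y)) (Hcontr x y).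
rewrite lee_fin !RintegralZl//; try exact: integrable_kernel gA.
by rewrite -mulrBr ler_pdivrMl// mulrA.
Qed.

(** The point [y] acts twice: as the starting point of the remaining chain, and as the first entry
    of the path. The second effect costs at most [K * dist y z]. *)
Lemma chainR_integrand_lipschitz_step n K F : 0 < K ->
  (forall G, coord_lipschitz dist K G ->
     dlipschitz dist (K / kappa * (1 - kappa)) (fun x => chainR P n x G)) ->
  (forall G H c, coord_lipschitz dist K G -> coord_lipschitz dist K H ->
     (forall s, G s <= H s + c) -> forall x, chainR P n x G <= chainR P n x H + c) ->
  coord_lipschitz dist K F ->
  dlipschitz dist (K / kappa) (fun y => chainR P n y (fun s => F (y :: s))).
Proof.
move=> K0 IHlip IHle FK.
suff H y z : chainR P n y (fun s => F (y :: s)) - chainR P n z (fun s => F (z :: s))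
    <= K / kappa * dist y z.
  move=> y z; rewrite ler_norml H andbT.
  by have := H z y; rewrite (dist_sym dist Hd z y); lra.
have Fy : coord_lipschitz dist K (fun s => F (y :: s)) by exact: coord_lipschitz_cons.
have Fz : coord_lipschitz dist K (fun s => F (z :: s)) by exact: coord_lipschitz_cons.
have h1 := le_trans (ler_norm _) (IHlip _ Fy y z).
have h2 := IHle _ _ (K * dist y z) Fy Fz
  (fun s => ltac:(by have := FK [::] y z s; rewrite ler_norml /=; lra)) z.
(* [K / kappa] is the fixed point of [A = A (1 - kappa) + K], the sum of the geometric series of the
   effects of one coordinate on all later steps. *)
have -> : K / kappa * dist y z = K / kappa * (1 - kappa) * dist y z + K * dist y z.
  by field; rewrite gt_eqF.
by lra.
Qed.

(** The two claims need a joint induction: comparing real integrals requires integrability, which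
    comes from the Lipschitz bound, and that bound uses the comparison up to a constant. *)
Lemma chainR_lipschitz_le n K : 0 < K ->
  (forall F, coord_lipschitz dist K F ->
     dlipschitz dist (K / kappa * (1 - kappa)) (fun x => chainR P n x F)) /\
  (forall F G c, coord_lipschitz dist K F -> coord_lipschitz dist K G ->
     (forall s, F s <= G s + c) -> forall x, chainR P n x F <= chainR P n x G + c).
Proof.
move=> K0; elim: n => [|n [IHlip IHle]].
  split=> [F FK x y|F G c _ _ FG x]; last exact: FG.
  by rewrite subrr normr0 !mulr_ge0 ?invr_ge0 ?(ltW K0) ?(ltW Hkappa) ?subr_ge0 ?(dist_ge0 dist Hd).
have Kk0 : 0 < K / kappa by rewrite divr_gt0.
have lip F := chainR_integrand_lipschitz_step n K F K0 IHlip IHle.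
split=> [F FK|F G c FK GK FG x] /=; first exact/kernel_contraction/lip.
have iF := integrable_kernel x _ _ Kk0 (lip _ FK).
have iG := integrable_kernel x _ _ Kk0 (lip _ GK).
have mu1 : P x setT = 1%E := prob_kernel x.
rewrite -probability_RintegralDcst//; apply: le_Rintegral => //.
  exact: (integrableD measurableT iG (probability_integrable_cst (P x) mu1 c)).
by move=> y _; apply: IHle => [||s]; try exact: coord_lipschitz_cons.
Qed.

Lemma chainR_integrand_lipschitz n K F : 0 < K -> coord_lipschitz dist K F ->
  dlipschitz dist (K / kappa) (fun y => chainR P n y (fun s => F (y :: s))).
Proof.
move=> K0; have [IHlip IHle] := chainR_lipschitz_le n K K0.
exact: chainR_integrand_lipschitz_step.
Qed.

Lemma chainR_integrand_integrable n K F x : 0 < K -> coord_lipschitz dist K F ->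
  (P x).-integrable setT (EFin \o (fun y => chainR P n y (fun s => F (y :: s)))).
Proof.
move=> K0 FK; apply: integrable_kernel (chainR_integrand_lipschitz n _ _ K0 FK).
exact: divr_gt0.
Qed.

Lemma chainE_EFin n x K F : 0 < K -> coord_lipschitz dist K F ->
  chainE P n x (fun s => (F s)%:E) = (chainR P n x F)%:E.
Proof.
move=> K0; elim: n x F => [//|n IH] x F FK /=.
rewrite -EFin_Rintegral; last exact: chainR_integrand_integrable FK.
by apply: eq_integral => y _; apply: IH; exact: coord_lipschitz_cons.
Qed.

Lemma chainRB n x K F G H : 0 < K -> coord_lipschitz dist K F ->
  coord_lipschitz dist K G -> (forall s, H s = F s - G s) ->
  chainR P n x H = chainR P n x F - chainR P n x G.
Proof.
move=> K0; elim: n x F G H => [|n IH] x F G H FK GK HFG /=; first exact: HFG.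
rewrite -RintegralB//; try exact: chainR_integrand_integrable K0 _.
by apply: eq_Rintegral => y _; apply: IH => [||s]; [exact: coord_lipschitz_cons..|exact: HFG].
Qed.

(** Positive and negative parts of [F] keep the constant [K], so both have finite expectations that
    can be subtracted. *)
Lemma chainExp_chainR n x K F : 0 < K -> coord_lipschitz dist K F ->
  chainExp P n x F = chainR P n x F.
Proof.
move=> K0 FK; rewrite /chainExp.
have Fp : coord_lipschitz dist K (fun s => Num.max (F s) 0).
  move=> p y z s; apply: le_trans (FK p y z s).
  exact: ler_norm_max0.
have Fm : coord_lipschitz dist K (fun s => Num.max (- F s) 0).
  move=> p y z s; apply: le_trans (FK p y z s).
  by apply: le_trans (ler_norm_max0 _ _ _) _; rewrite -opprD normrN.
rewrite !(chainE_EFin _ _ K)//= -(chainRB _ _ K _ _ F)// => s.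
by case: (leP (F s) 0); case: (leP (- F s) 0); lra.
Qed.

Lemma le_chainE n x (F G : seq X -> \bar R) : (forall s, F s <= G s)%E ->
  (chainE P n x F <= chainE P n x G)%E.
Proof.
elim: n x F G => [|n IH] x F G FG /=; first exact: FG.
by apply: le_integral_pointwise => y; exact: IH.
Qed.

Hypothesis Hsinf : (sigma_inf dist P < +oo)%E.
Hypothesis Hsn : (sup_sigma2_n dist P < +oo)%E.
Let S := fine (sup_sigma2_n dist P).
Let D := 2 * fine (sigma_inf dist P).

(** The one-step bound for [g / A] at parameter [t * A]. *)
Lemma kernel_mgf_le x A g t : 0 < A -> dlipschitz dist A g ->
  `|t| * A * D <= 2^-1 ->
  (\int[P x]_y (expR (t * g y))%:E
   <= (expR (4 * (t * A) ^+ 2 * S) * expR (t * \int[P x]_y g y))%:E)%E.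
Proof.
move=> A0 gA tAD; have g1 := dlipschitz_normalize _ _ A0 gA.
have A1 : A != 0 by rewrite gt_eqF.
have := one_lipschitz_mgf_le dist Hd Hborel (P x) (prob_kernel x) (Hmom x)
  _ D (ae_dsupport_kernel dist P Hpolish Hborel x)
  (dist_dsupport_le dist P Hsinf x) _ g1 S
  (double_integral_one_lipschitz_le dist P Hpolish Hborel Hsinf Hsn x _ g1) (t * A).
rewrite normrM (gtr0_norm A0) => /(_ tAD).
rewrite RintegralZl//; last exact: integrable_kernel gA.
have E w : t * A * (A^-1 * w) = t * w by field.
by rewrite E expRD (mulrC (expR (t * _))); under eq_integral do rewrite E.
Qed.

(** Induction peels off the first step: the inner expectation is bounded through [g], which is
    [K / kappa]-Lipschitz, and one more kernel step costs one factor. Both signs of [t] are carried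
    together, so that additivity is used only for measurable functions of [g]. *)
Lemma chainE_mgf_le n x K F t u v : 0 < K -> coord_lipschitz dist K F ->
  `|t| * (K / kappa) * D <= 2^-1 -> 0 <= u -> 0 <= v ->
  (chainE P n x (fun s => (u * expR (t * F s) + v * expR (- t * F s))%:E)
   <= (expR (n%:R * (4 * (t * (K / kappa)) ^+ 2 * S)) *
       (u * expR (t * chainR P n x F) + v * expR (- t * chainR P n x F)))%:E)%E.
Proof.
move=> K0; set c := 4 * _ * S => FK tKD u0 v0; elim: n x F FK => [|n IH] x F FK.
  by rewrite mul0r expR0 mul1r.
pose g y := chainR P n y (fun s => F (y :: s)).
have gA := chainR_integrand_lipschitz n _ _ K0 FK; rewrite -/g in gA.
have A0 : 0 < K / kappa by rewrite divr_gt0.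
have mg : measurable_fun setT g.
  exact: (measurable_dlipschitz dist Hd Hborel _ _ (ltW A0) gA).
have me t' : measurable_fun setT (fun y => (expR (t' * g y))%:E).
  by apply/measurable_EFinP; apply: measurableT_comp => //; exact: measurable_funM.
pose e := expR (n%:R * c).
apply: (@le_trans _ _ (\int[P x]_y ((e * u)%:E * (expR (t * g y))%:E
   + (e * v)%:E * (expR (- t * g y))%:E))%E).
  apply: le_integral_pointwise => y; apply: le_trans (IH y _ _) _.
    exact: coord_lipschitz_cons.
  rewrite -!EFinM -EFinD lee_fin -/e -/(g y) le_eqVlt; apply/orP; left.
  by apply/eqP; ring.
have e0 : 0 <= e by exact: expR_ge0.
have m0 t' : (0 <= \int[P x]_y (expR (t' * g y))%:E)%E.
  by apply: integral_ge0 => y _; rewrite lee_fin expR_ge0.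
rewrite ge0_integralD//=; last 4 first.
- by move=> y _; rewrite -EFinM lee_fin !mulr_ge0 ?expR_ge0.
- exact: measurable_funeM.
- by move=> y _; rewrite -EFinM lee_fin !mulr_ge0 ?expR_ge0.
- exact: measurable_funeM.
rewrite !ge0_integralZl_EFin//; try by [move=> y _; rewrite lee_fin expR_ge0|exact: mulr_ge0].
have tN : `|- t| * (K / kappa) * D <= 2^-1 by rewrite normrN.
have h1 := kernel_mgf_le x _ _ _ A0 gA tKD.
have h2 := kernel_mgf_le x _ _ _ A0 gA tN.
apply: (le_trans (leeD (lee_wpmul2l _ h1) (lee_wpmul2l _ h2))).
- by rewrite lee_fin mulr_ge0.
- by rewrite lee_fin mulr_ge0.
rewrite -!EFinM -EFinD lee_fin mulNr sqrrN -/c -natr1 mulrDl mul1r expRD -/e /= -/g.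
by rewrite le_eqVlt; apply/orP; left; apply/eqP; ring.
Qed.

End contracting_chain.

(** * The Lipschitz constant of the observable and of its empirical mean *)

Section lipschitz_constant.
Context {R : realType} {X : Type}.
Variables (dist : X -> X -> R) (f : X -> R).
Hypotheses (Hd : is_metric dist) (Hlip : (lipnorm dist f < +oo)%E).

Let dist_gt0 y z : y <> z -> 0 < dist y z.
Proof.
case: Hd => d0 d1 _ _ yz; rewrite lt_neqAle d0 andbT eq_sym.
by apply/eqP => /d1.
Qed.

Let lipnorm_ge y z : y <> z -> `|f y - f z| / dist y z <= fine (lipnorm dist f).
Proof.
move=> yz; have : ((`|f y - f z| / dist y z)%:E <= lipnorm dist f)%E.
  by apply: ereal_sup_ubound; exists y, z.
by move: Hlip; case: (lipnorm dist f).
Qed.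

Lemma dlipschitz_lipnorm : dlipschitz dist (fine (lipnorm dist f)) f.
Proof.
move=> y z; have [->|yz] := pselect (y = z).
  by case: Hd => _ /(_ z z)[_ ->]// _ _; rewrite subrr normr0 mulr0.
by rewrite -ler_pdivrMr ?dist_gt0//; exact: lipnorm_ge.
Qed.

Lemma lipnorm_gt0 : (exists y z, f y <> f z) -> 0 < fine (lipnorm dist f).
Proof.
move=> [y [z fyz]]; have yz : y <> z by move=> yz; apply: fyz; rewrite yz.
apply: lt_le_trans (lipnorm_ge _ _ yz); rewrite divr_gt0 ?dist_gt0//.
by rewrite normr_gt0 subr_eq0; apply/eqP.
Qed.

End lipschitz_constant.

Lemma pihat_coord_lipschitz (R : realType) (d : measure_display)
    (X : measurableType d) (dist : X -> X -> R) (f : X -> R) (L : R) (x : X) (T T0 : nat) :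
  is_metric dist -> 0 <= L ->
  dlipschitz dist L f -> coord_lipschitz dist (L / T%:R) (pihat x T T0 f).
Proof.
move=> Hd L0 fL p y z s; rewrite /pihat -mulrBr -sumrB normrM ger0_norm ?invr_ge0//.
rewrite (mulrC L) -mulrA ler_wpM2l ?invr_ge0//.
have Ld0 : 0 <= L * dist y z by case: Hd => d0 _ _ _; rewrite mulr_ge0.
(* Changing one entry affects at most one summand. As [X_k] is stored at position [k - 1], the entry
   at position [size p] belongs to [k = size p + 1]. *)
apply: (@le_trans _ _ (\sum_(T0.+1 <= k < (T0 + T).+1 | k == (size p).+1) L * dist y z)).
  rewrite [leRHS]big_mkcond/=; apply: le_trans (ler_norm_sum _ _ _) _.
  apply: ler_sum_nat => -[//|k] _ /=.
  rewrite eqSS !nth_cat; case: ltngtP => [kp|pk|->].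
  - by rewrite subrr normr0.
  - by rewrite -(subnSK pk) /= subrr normr0.
  - by rewrite subnn.
by rewrite big_nat1_eq; case: ifP.
Qed.

(** * Chernoff's method for the two-sided deviation *)

Section chernoff.
Context {d : measure_display} {X : measurableType d} {R : realType}.
Variables (dist : X -> X -> R) (P : R.-pker X ~> X).
Hypotheses (Hpolish : polish_metric dist) (Hborel : borel_of_metric dist).
Hypothesis Hmom : forall x, finite_first_moment dist (P x).
Variable kappa : R.
Hypothesis Hkappa : 0 < kappa.
Hypothesis Hcontr : forall x y : X,
  (W1 dist (P x) (P y) <= ((1 - kappa) * dist x y)%:E)%E.

(** [W1] is an infimum of nonnegative integrals, so [1 - kappa] cannot be negative once two points
    are at positive distance. *)
Lemma contraction_rate_le1 (y z : X) : y <> z -> kappa <= 1.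
Proof.
move=> yz; have [d0 d1 _ _] : is_metric dist by case: Hpolish.
have dyz : 0 < dist y z.
  by rewrite lt_neqAle d0 andbT eq_sym; apply/eqP => /d1.
have : (0 <= ((1 - kappa) * dist y z)%:E)%E.
  apply: le_trans (Hcontr y z); apply: le_ereal_inf_tmp => _ [xi _ <-].
  by apply: integral_ge0 => p _; rewrite lee_fin.
by rewrite lee_fin pmulr_lge0// subr_ge0.
Qed.

Hypothesis Hkappa1 : kappa <= 1.
Hypothesis Hsinf : (sigma_inf dist P < +oo)%E.
Hypothesis Hsn : (sup_sigma2_n dist P < +oo)%E.
Let S := fine (sup_sigma2_n dist P).
Let D := 2 * fine (sigma_inf dist P).

Lemma chainP_deviation_le n x K F t a : 0 < K -> coord_lipschitz dist K F ->
  0 <= t -> t * (K / kappa) * D <= 2^-1 ->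
  (chainP P n x [set s | (a <= `|F s - chainExp P n x F|)%R]
   <= (2 * expR (n%:R * (4 * (t * (K / kappa)) ^+ 2 * S) - t * a))%:E)%E.
Proof.
move=> K0 FK t0 tKD; rewrite (chainExp_chainR dist P Hpolish Hborel Hmom _
  Hkappa Hkappa1 Hcontr n x K F K0 FK).
set m := chainR P n x F.
(* With these weights the integrand is [expR (t (F - m) - t a) + expR (- t (F - m) - t a)], which
   dominates the indicator of both tails; at [F = m] it equals [2 expR (- t a)]. *)
pose u := expR (- t * m - t * a); pose v := expR (t * m - t * a).
apply: (@le_trans _ _ (chainE P n x
    (fun s => (u * expR (t * F s) + v * expR (- t * F s))%:E))).
  apply: le_chainE => s; rewrite lee_fin indicE.
  have w0 : 0 <= u * expR (t * F s) by rewrite mulr_ge0 ?expR_ge0.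
  have w1 : 0 <= v * expR (- t * F s) by rewrite mulr_ge0 ?expR_ge0.
  case: (boolP (s \in _)) => [/set_mem /= aF|_]; last exact: addr_ge0.
  have [aF1|aF1] : a <= F s - m \/ a <= m - F s.
    by move: aF; rewrite ler_normr opprB => /orP.
  - apply: (@le_trans _ _ (u * expR (t * F s))); last by rewrite lerDl.
    rewrite -expRD -expR0 ler_expR; nra.
  - apply: (@le_trans _ _ (v * expR (- t * F s))); last by rewrite lerDr.
    rewrite -expRD -expR0 ler_expR; nra.
have tKD' : `|t| * (K / kappa) * D <= 2^-1 by rewrite ger0_norm.
apply: le_trans (chainE_mgf_le dist P Hpolish Hborel Hmom _ Hkappa Hkappa1 Hcontr
  Hsinf Hsn n x K F t u v K0 FK tKD' (expR_ge0 _) (expR_ge0 _)) _.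
have uE : u * expR (t * m) = expR (- (t * a)) by rewrite -expRD; congr expR; ring.
have vE : v * expR (- t * m) = expR (- (t * a)) by rewrite -expRD; congr expR; ring.
rewrite lee_fin -/m -/S uE vE expRD le_eqVlt; apply/orP; left; apply/eqP; ring.
Qed.

End chernoff.

Theorem theorem4 (R : realType) (d : measure_display) (X : measurableType d)
  (dist : X -> X -> R) (P : R.-pker X ~> X)
  (Hpolish : polish_metric dist) (Hborel : borel_of_metric dist)
  (Hmom : forall x : X, finite_first_moment dist (P x))
  (kappa : R) (Hkappa : 0 < kappa)
  (Hcontr : forall x y : X,
     (W1 dist (P x) (P y) <= ((1 - kappa) * dist x y)%:E)%E)
  (Hsinf : (sigma_inf dist P < +oo)%E)
  (Hsn : (sup_sigma2_n dist P < +oo)%E)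
  (T T0 : nat) (HT : (1 <= T)%N)
  (f : X -> R) (Hlip : (lipnorm dist f < +oo)%E)
  (Hnonconst : exists y z : X, f y <> f z)
  (x : X) (r : R) (Hr : 0 < r) :
  let V2 := (kappa * T%:R)^-1 * (1 + T0%:R / T%:R)
            * (fine (sup_sigma2_n dist P) / kappa) in
  let sinf := fine (sigma_inf dist P) in
  let rmax := 4 * V2 * kappa * T%:R / (3 * sinf) in
  let L := fine (lipnorm dist f) in
  let mean := chainExp P (T0 + T) x (pihat x T T0 f) in
  (chainP P (T0 + T) x [set s : seq X | (r <= `|pihat x T T0 f s - mean| / L)%R]
   <= (if (r < rmax)%R then 2 * expR (- r ^+ 2 / (16 * V2))
       else 2 * expR (- (kappa * T%:R * r) / (12 * sinf)))%:E)%E.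
Proof.
cbv zeta; set V2 := (kappa * T%:R)^-1 * _ * _; set sinf := fine (sigma_inf dist P).
set rmax := 4 * V2 * kappa * T%:R / (3 * sinf); set L := fine (lipnorm dist f).
set mean := chainExp P _ _ _.
have Hd : is_metric dist by case: Hpolish.
have L0 : 0 < L by exact: lipnorm_gt0.
have fL : dlipschitz dist L f by exact: dlipschitz_lipnorm.
have k1 : kappa <= 1.
  have [y [z fyz]] := Hnonconst.
  by apply: (contraction_rate_le1 dist P Hpolish kappa Hcontr y z) => yz; apply: fyz; rewrite yz.
have T0' : 0 < T%:R :> R by rewrite ltr0n.
have kT : 0 < kappa * T%:R by rewrite mulr_gt0.
have FK := pihat_coord_lipschitz R d X dist f L x T T0 Hd (ltW L0) fL.
have K0 : 0 < L / T%:R by rewrite divr_gt0.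
have S0 := sup_sigma2_n_fine_ge0 dist P x.
have V20 : 0 <= V2.
  by rewrite /V2 !mulr_ge0 ?addr_ge0 ?invr_ge0 ?(ltW kT) ?mulr_ge0 ?invr_ge0 ?(ltW Hkappa) ?(ltW T0').
(* The deviation bound at [t = l / L] with [K = L / T]. The condition on [l] is the smallness
   condition with [D = 2 sinf], and [V2 = (T0 + T) S / (kappa T)^2], where [S] is the real value of
   [sup_sigma2_n], collects the variance terms. *)
have chernoff l : 0 <= l -> l * (4 * sinf) <= kappa * T%:R ->
    (chainP P (T0 + T) x [set s : seq X | (r <= `|pihat x T T0 f s - mean| / L)%R]
     <= (2 * expR (4 * l ^+ 2 * V2 - l * r))%:E)%E.
  move=> l0 lk.
  have tK : l / L * (L / T%:R / kappa) = l / (kappa * T%:R).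
    by field; rewrite !gt_eqF.
  have tKD : l / L * (L / T%:R / kappa) * (2 * sinf) <= 2^-1.
    by rewrite tK mulrAC ler_pdivrMr//; lra.
  have := chainP_deviation_le dist P Hpolish Hborel Hmom kappa Hkappa Hcontr k1
    Hsinf Hsn (T0 + T) x _ _ (l / L) (r * L) K0 FK (divr_ge0 l0 (ltW L0)) tKD.
  rewrite tK.
  have -> : [set s | r * L <= `|pihat x T T0 f s - mean|] =
      [set s | r <= `|pihat x T T0 f s - mean| / L].
    by apply/seteqP; split => s /=; rewrite ler_pdivlMr.
  congr (_ <= (2 * expR _)%:E)%E; rewrite natrD /V2.
  by field; rewrite !gt_eqF.
(* If [sinf <= 0], with division by zero giving 0, then [rmax <= 0] and the second regime applies.
   Its exponent is nonnegative, so the trivial bound 2 at [l = 0] suffices. *)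
clearbody V2 sinf mean; have [sinf0|sinf0] := leP sinf 0.
  have rmax0 : rmax <= 0.
    apply: mulr_ge0_le0; last by rewrite invr_le0; lra.
    by rewrite !mulr_ge0 ?(ltW Hkappa).
  rewrite ltNge (le_trans rmax0 (ltW Hr))/=.
  apply: le_trans (chernoff 0 (lexx 0) _) _; first by rewrite mul0r ltW.
  rewrite lee_fin ler_wpM2l// ler_expR expr0n/= mulr0 !mul0r subrr.
  by rewrite mulr_le0// ?invr_le0 ?oppr_le0; [rewrite mulr_ge0// ltW|lra].
case: ltP => [rr|rr].
  have V2p : 0 < V2.
    rewrite lt_neqAle V20 andbT eq_sym; apply/eqP => V2e.
    by move: rr; rewrite /rmax V2e !(mulr0, mul0r) ltNge ltW.
  (* This [l] minimises [4 l^2 V2 - l r]; [r < rmax] means [l < kappa T / (6 sinf)], which is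
     admissible. *)
  apply: le_trans (chernoff (r / (8 * V2)) _ _) _.
  - by rewrite divr_ge0 ?mulr_ge0 ?ltW.
  - move: rr; rewrite /rmax ltr_pdivlMr ?mulr_gt0// [leLHS]mulrAC ler_pdivrMr ?mulr_gt0//.
    nra.
  - rewrite lee_fin ler_wpM2l// ler_expR le_eqVlt; apply/orP; left; apply/eqP.
    by field; rewrite gt_eqF.
(* The optimal parameter for [r = rmax] is kept for all larger [r]. The exponent is then
   [l (rmax / 2 - r)], at most [- l r / 2]. *)
apply: le_trans (chernoff (kappa * T%:R / (6 * sinf)) _ _) _.
- by rewrite divr_ge0 ?mulr_ge0 ?ltW.
- rewrite [leLHS]mulrAC ler_pdivrMr ?mulr_gt0//; nra.
- rewrite lee_fin ler_wpM2l// ler_expR.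
  set l := kappa * T%:R / (6 * sinf).
  have l0 : 0 <= l by rewrite divr_ge0 ?mulr_ge0 ?ltW.
  have -> : 4 * l ^+ 2 * V2 = l * (rmax / 2) by rewrite /l /rmax; field; rewrite gt_eqF.
  have -> : - (kappa * T%:R * r) / (12 * sinf) = l * (r / 2) - l * r.
    by rewrite /l; field; rewrite gt_eqF.
  by rewrite lerD2r ler_wpM2l//; lra.
Qed.
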